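(* Let $S,W,K$ be integers with $1\le K<W\le S$, let $\ell\ge 1$ be an integer and let $d'\in\{1,\dots,K\}$. Put $S'=S-d'$, $W'=W-d'$, $K'=K-d'$, and $$C_{\ell,u}=\sum_{k=0}^{u}(-1)^k\binom{u}{k}(u-k)^{\ell}\quad(1\le u\le \ell),\qquad A=\sum_{u=1}^{\ell}\frac{\binom{W'}{u}^2\,C_{\ell,u}}{\binom{S'}{u}} ,$$ where summands with $u>W'$ (whose numerators vanish) are taken to be $0$. If $A-(K')^{\ell}>0$, then for every $(S,N,W,K)$ binary constant-weight code the number $N$ of codewords satisfies $$N\le\left\lfloor\frac{S}{W}\left\lfloor\frac{S-1}{W-1}\left\lfloor\cdots\left\lfloor\frac{S'+1}{W'+1}\left\lfloor\frac{(W')^{\ell}-(K')^{\ell}}{A-(K')^{\ell}}\right\rfloor\right\rfloor\cdots\right\rfloor\right\rfloor\right\rfloor ,$$ where the outer nested floors run over the $d'$ fractions $\frac{S-r}{W-r}$, $r=0,1,\dots,d'-1$, with $r=0$ outermost.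
   Context: An $(S,N,W,K)$ binary constant-weight code (CWC) is a set of $N$ distinct codewords $x_1,\dots,x_N\in\{0,1\}^S$, $x_j=(x_{j,0},\dots,x_{j,S-1})$, each of Hamming weight exactly $W$, such that for all $j\ne j'$ the number of overlapping ones satisfies $\gamma_{j,j'}:=\sum_{s=0}^{S-1}x_{j,s}x_{j',s}\le K$. *)

(* Defs.v *)
From mathcomp Require Import all_boot all_order all_algebra.

Set Implicit Arguments.
Unset Strict Implicit.
Unset Printing Implicit Defensive.

Import Order.TTheory GRing.Theory Num.Theory.

Local Open Scope ring_scope.

Definition word (S : nat) := {ffun 'I_S -> bool}.

Definition weight (S : nat) (x : word S) : nat := (\sum_(s < S) x s)%N.

Definition overlap (S : nat) (x y : word S) : nat := (\sum_(s < S) x s * y s)%N.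

Definition is_cwc (S N W K : nat) (X : {set word S}) : Prop :=
  [/\ #|X| = N,
      forall x, x \in X -> weight x = W
    & forall x y, x \in X -> y \in X -> x != y -> (overlap x y <= K)%N].

Definition C_coef (l u : nat) : int :=
  \sum_(0 <= k < u.+1) (-1) ^+ k * 'C(u, k)%:Z * (u - k)%N%:Z ^+ l.

(* The summands with W < u <= l, whose denominators may vanish too, are
   omitted. *)
Definition A_coef (l S W : nat) : rat :=
  \sum_(1 <= u < l.+1 | (u <= W)%N)
    ('C(W, u)%:R ^+ 2 * (C_coef l u)%:~R) / 'C(S, u)%:R.

(* The step for r = 0 is applied last, hence is the outermost floor.  The
   subtractions are on nat and are exact when d <= W <= S. *)
Definition nested_floor (S W d : nat) (B : int) : int :=
  foldr (fun r z => Num.floor ((S - r)%N%:R / (W - r)%N%:R * z%:~R : rat))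
    B (iota 0 d).

(* Main.v *)
(* The l-th moment of the overlaps of all ordered pairs of codewords is at most
   N W^l + N (N-1) K^l.  As C_{l,u} counts surjections from an l-set onto a
   u-set, g^l = sum_u C(g,u) C_{l,u}; the sum of C(overlap,u) over pairs is the
   sum over u-sets U of the squared number of codewords containing U, which
   Cauchy-Schwarz bounds below by (N C(W,u))^2 / C(S,u).  Hence N^2 A is a lower
   bound for the moment, and N (A - K^l) <= W^l - K^l.  Shortening the code at
   each coordinate and averaging, d' times, gives the nested floors. *)
Require Import Defs.
From mathcomp Require Import all_boot all_order all_algebra.
From mathcomp Require Import zify ring lra.

Set Implicit Arguments.
Unset Strict Implicit.
Unset Printing Implicit Defensive.

Import Order.TTheory GRing.Theory Num.Theory.

Local Open Scope ring_scope.

(** * Surjection numbers and the expansion of powers *)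

Lemma C_coef0l u : C_coef 0 u = (u == 0)%:R.
Proof.
(* For [l = 0] the alternating sum is the binomial expansion of [(1 - 1) ^ u]. *)
have := exprDn (1 : int) (-1) u; rewrite subrr expr0n => ->.
rewrite /C_coef big_mkord; apply: eq_bigr => k _.
by rewrite expr0 expr1n mulr1 mul1r -mulr_natr natz.
Qed.

Lemma C_coefS0 l : C_coef l.+1 0 = 0.
Proof. by rewrite /C_coef big_nat1 subnn expr0n mulr0. Qed.

(* Absorption [(u+1-k) C(u+1,k) = (u+1) C(u,k)] on the left, Pascal's rule on
   the right, both reduce to the same alternating sum. *)
Lemma C_coefSS l u :
  C_coef l.+1 u.+1 = u.+1%:Z * (C_coef l u.+1 + C_coef l u).
Proof.
pose D := \sum_(0 <= k < u.+1) (-1) ^+ k * 'C(u, k)%:Z * (u.+1 - k)%N%:Z ^+ l.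
have absorb : C_coef l.+1 u.+1 = u.+1%:Z * D.
  rewrite /C_coef big_nat_recr //= subnn expr0n mulr0 addr0 mulr_sumr.
  apply: eq_big_nat => k _.
  have /(congr1 Posz) := mul_bin_down u.+1 k; rewrite !PoszM mulrC => /= e.
  rewrite exprS.
  transitivity ((-1) ^+ k * ('C(u.+1, k)%:Z * (u.+1 - k)%N%:Z)
                 * (u.+1 - k)%N%:Z ^+ l); first by ring.
  by rewrite [X in _ * X * _]mulrC -e; ring.
have pascal : C_coef l u.+1 = D - C_coef l u.
  rewrite /C_coef big_nat_recl // /D.
  rewrite [X in _ = X - _]big_nat_recl // !bin0 -addrA; congr (_ + _).
  under eq_bigr do rewrite binS PoszD subSS mulrDr mulrDl.
  rewrite big_split /= big_nat_recr //= bin_small // mulr0 mul0r addr0.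
  rewrite -sumrN; congr (_ + _); apply: eq_bigr => k _.
  by rewrite exprS !mulNr mul1r.
by rewrite absorb pascal subrK.
Qed.

(** The defining sum alternates in sign, but the recurrence [C_coefSS] has only nonnegative
    terms. *)
Lemma C_coef_ge0 l u : 0 <= C_coef l u.
Proof.
elim: l u => [|l IH] [|u]; rewrite ?C_coef0l ?C_coefS0 ?ler0n //.
by rewrite C_coefSS mulr_ge0 ?addr_ge0.
Qed.

Lemma C_coef_small l u : (l < u)%N -> C_coef l u = 0.
Proof.
elim: l u => [|l IH] [|u] //; first by rewrite C_coef0l.
by move=> lu; rewrite C_coefSS !IH ?addr0 ?mulr0 // ltnW.
Qed.

(** Combinatorially, this sorts the maps from an [l]-set to a [g]-set by their image. The proof is
    by induction on [l]: multiplying by [g] and regrouping by [u] reproduces the recurrence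
    [C_coefSS]. *)
Lemma expn_sum_C_coef l g :
  g%:Z ^+ l = \sum_(0 <= u < l.+1) 'C(g, u)%:Z * C_coef l u.
Proof.
elim: l => [|l IH]; first by rewrite big_nat1 C_coef0l bin0.
rewrite exprS IH mulr_sumr [RHS]big_nat_recl // C_coefS0 mulr0 add0r.
(* Write [g = u + (g - u)] and absorb [g - u] into the binomial; for [g < u], where the subtraction
   truncates, both binomials vanish. *)
have step u : g%:Z * ('C(g, u)%:Z * C_coef l u) =
    u%:Z * 'C(g, u)%:Z * C_coef l u + u.+1%:Z * 'C(g, u.+1)%:Z * C_coef l u.
  have [gu|ug] := ltnP g u.
    by rewrite !bin_small //; [ring | exact: ltnW].
  have := congr1 Posz (mul_bin_left g u); rewrite !PoszM -subzn // => ->.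
  by ring.
under [LHS]eq_bigr do rewrite step.
rewrite big_split /= [X in X + _]big_nat_recl // !mul0r add0r.
have -> : \sum_(0 <= i < l) i.+1%:Z * 'C(g, i.+1)%:Z * C_coef l i.+1 =
          \sum_(0 <= i < l.+1) i.+1%:Z * 'C(g, i.+1)%:Z * C_coef l i.+1.
  by rewrite [RHS]big_nat_recr //= (C_coef_small (ltnSn l)) mulr0 addr0.
rewrite -big_split /=; apply: eq_bigr => u _.
by rewrite C_coefSS; ring.
Qed.

(** Cauchy-Schwarz against the constant 1: sum [2 * a i * a j <= a i ^ 2 + a j ^ 2] over all ordered
    pairs. *)
Lemma sum_sqr_ge (I : finType) (P : {set I}) (a : I -> nat) :
  ((\sum_(i in P) a i) ^ 2 <= #|P| * \sum_(i in P) a i ^ 2)%N.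
Proof.
rewrite -(leq_pmul2l (_ : 0 < 2)%N) //.
have -> : (2 * (#|P| * \sum_(i in P) a i ^ 2) =
    \sum_(i in P) \sum_(j in P) (a i ^ 2 + a j ^ 2))%N.
  under [RHS]eq_bigr do rewrite big_split /= sum_nat_const.
  by rewrite big_split /= -big_distrr sum_nat_const /= mul2n addnn.
rewrite -mulnn big_distrlr /= big_distrr /=; apply: leq_sum => i _.
by rewrite big_distrr /=; apply: leq_sum => j _; exact: nat_Cauchy.
Qed.

(** Peeling off the outermost floor leaves the nest for length [S - 1] and weight [W - 1], the
    parameters of a shortened code; this drives the induction on [d]. *)
Lemma nested_floorS S W d (z : int) :
  nested_floor S W d.+1 z =
  Num.floor (S%:R / W%:R * (nested_floor S.-1 W.-1 d z)%:~R : rat).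
Proof.
rewrite /nested_floor /= !subn0 (iotaDl 1 0) foldr_map.
congr (Num.floor (_ * _%:~R)); elim: (iota 0 d) => //= r s ->.
by rewrite -!subn1 -!subnDA.
Qed.

(** * Set families with bounded pairwise intersections *)

Section SetFamilies.
(** The ground set is a subset [D] of [T], so that shortening can delete a point without changing
    the type. *)
Variables (I T : finType).
Implicit Types (X : {set I}) (F : I -> {set T}) (D B : {set T}).

Lemma sum_subset_bin D B u : B \subset D ->
  (\sum_(U : {set T} | (U \subset D) && (#|U| == u)) (U \subset B) =
   'C(#|B|, u))%N.
Proof.
move=> BD; rewrite -cards_draws -sum1dep_card.
rewrite [RHS]big_mkcond [LHS]big_mkcond.
apply: eq_bigr => U _; case UB: (U \subset B); last by rewrite if_same.
by rewrite (subset_trans UB BD).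
Qed.

Lemma sum_bin_overlap X F D w u :
  (forall x, x \in X -> F x \subset D) -> (forall x, x \in X -> #|F x| = w) ->
  ((#|X| * 'C(w, u)) ^ 2 <=
   'C(#|D|, u) * \sum_(x in X) \sum_(y in X) 'C(#|F x :&: F y|, u))%N.
Proof.
move=> FD Fw.
pose P := [set U : {set T} | (U \subset D) && (#|U| == u)].
pose deg (U : {set T}) := (\sum_(x in X) (U \subset F x))%N.
have sub B : B \subset D -> (\sum_(U in P) (U \subset B) = 'C(#|B|, u))%N.
  move=> BD; rewrite -(sum_subset_bin u BD).
  by apply: eq_bigl => U; rewrite inE.
have deg1 : (\sum_(U in P) deg U = #|X| * 'C(w, u))%N.
  rewrite exchange_big /= -sum_nat_const; apply: eq_bigr => x xX.
  by rewrite sub ?FD // Fw.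
have deg2 : (\sum_(U in P) deg U ^ 2 =
    \sum_(x in X) \sum_(y in X) 'C(#|F x :&: F y|, u))%N.
  (* The square counts pairs of members both containing [U], that is, with [U] inside their
     intersection. *)
  under eq_bigr do rewrite -mulnn big_distrlr /=.
  rewrite exchange_big /=; apply: eq_bigr => x xX.
  rewrite exchange_big /=; apply: eq_bigr => y yX.
  rewrite -sub ?(subset_trans (subsetIl _ _)) ?FD //.
  by apply: eq_bigr => U _; rewrite subsetI mulnb.
by rewrite -deg1 -deg2 -cards_draws sum_sqr_ge.
Qed.

Lemma sum_overlap_exp_ge X F D w l :
  (0 < l)%N -> (w <= #|D|)%N ->
  (forall x, x \in X -> F x \subset D) -> (forall x, x \in X -> #|F x| = w) ->
  #|X|%:R ^+ 2 * A_coef l #|D| w <=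
  \sum_(x in X) \sum_(y in X) #|F x :&: F y|%:R ^+ l.
Proof.
move=> l0 wD FD Fw.
have expand g : (g%:R : rat) ^+ l =
    \sum_(1 <= u < l.+1) 'C(g, u)%:R * (C_coef l u)%:~R.
  have := congr1 (intr : int -> rat) (expn_sum_C_coef l g).
  (* Since [l > 0] the term [u = 0] vanishes, so the sum starts at 1 as in [A_coef]. *)
  rewrite big_nat_recl // (_ : C_coef l 0 = 0); last first.
    by case: l l0 => // l _; exact: C_coefS0.
  rewrite mulr0 add0r rmorphXn rmorph_sum big_add1 /= => ->.
  by apply: eq_bigr => u _; rewrite rmorphM.
under [leRHS]eq_bigr do under eq_bigr do rewrite expand.
under [leRHS]eq_bigr do rewrite exchange_big.
rewrite exchange_big /= /A_coef mulr_sumr big_mkcond /=.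
apply: ler_sum => u _.
under [leRHS]eq_bigr do rewrite -mulr_suml.
rewrite -mulr_suml.
under [X in _ <= X * _]eq_bigr do rewrite -natr_sum.
rewrite -natr_sum.
have C0 : 0 <= (C_coef l u)%:~R :> rat by rewrite ler0z C_coef_ge0.
(* For [u > w], which [A_coef] omits, nonnegativity of the right-hand side suffices. *)
case: ifP => [uw|_]; last by rewrite mulr_ge0.
have b0 : 0 < 'C(#|D|, u)%:R :> rat.
  by rewrite ltr0n bin_gt0 (leq_trans uw).
rewrite mulrA mulrA -exprMn -[X in X / _]mulrC -mulrA [leRHS]mulrC.
apply: ler_wpM2l => //.
rewrite ler_pdivrMr // -natrM -natrX -natrM ler_nat.
by rewrite [leqRHS]mulnC; exact: sum_bin_overlap.
Qed.

Lemma card_family_bound X F D w k l :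
  let A := A_coef l #|D| w in
  (0 < l)%N -> (k <= w)%N -> (w <= #|D|)%N -> 0 < A - k%:R ^+ l ->
  (forall x, x \in X -> F x \subset D) -> (forall x, x \in X -> #|F x| = w) ->
  (forall x y, x \in X -> y \in X -> x != y -> (#|F x :&: F y| <= k)%N) ->
  #|X|%:R <= (w%:R ^+ l - k%:R ^+ l) / (A - k%:R ^+ l).
Proof.
move=> A l0 kw wD A0 FD Fw Fk.
have [->|X0] := eqVneq X set0.
  rewrite cards0 divr_ge0 ?(ltW A0) // subr_ge0.
  by rewrite lerXn2r ?nnegrE ?ler_nat.
have N0 : 0 < #|X|%:R :> rat by rewrite ltr0n card_gt0.
rewrite ler_pdivlMr // -(ler_pM2l N0).
have lb := sum_overlap_exp_ge l0 wD FD Fw.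
(* Each row has one diagonal term [w ^ l] and [#|X| - 1] others, each at most [k ^ l]. *)
have ub : \sum_(x in X) \sum_(y in X) (#|F x :&: F y|%:R : rat) ^+ l <=
    \sum_(x in X) (w%:R ^+ l + (#|X|%:R - 1) * k%:R ^+ l).
  apply: ler_sum => x xX.
  rewrite (bigD1 x) //= setIid Fw // lerD2l.
  have -> : #|X|%:R - 1 = #|X :\ x|%:R :> rat.
    by rewrite (cardsD1 x X) xX natrD addrC addKr.
  rewrite mulr_natl -sumr_const (eq_bigl (mem (X :\ x))); last first.
    by move=> y; rewrite /= !inE andbC.
  apply: ler_sum => y /setD1P[yx yX].
  by rewrite lerXn2r ?nnegrE ?ler_nat // Fk // eq_sym.
have {}ub := le_trans lb ub; rewrite sumr_const -mulr_natl in ub.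
by move: ub; rewrite -/A; lra.
Qed.

(* Johnson's shortening: each [s] in [D] selects the members containing [s],
   which with [s] removed form a family with parameters [w - 1], [k - 1];
   double counting incidences bounds [#|X| * w]. *)
Lemma card_family_nested_floor X F D w k l d :
  let A := A_coef l (#|D| - d) (w - d) in
  (0 < l)%N -> (d <= k)%N -> (k < w)%N -> (w <= #|D|)%N ->
  0 < A - (k - d)%:R ^+ l ->
  (forall x, x \in X -> F x \subset D) -> (forall x, x \in X -> #|F x| = w) ->
  (forall x y, x \in X -> y \in X -> x != y -> (#|F x :&: F y| <= k)%N) ->
  #|X|%:Z <= nested_floor #|D| w d
    (Num.floor (((w - d)%:R ^+ l - (k - d)%:R ^+ l) / (A - (k - d)%:R ^+ l))).
Proof.
elim: d X F D w k => [|d IH] X F D w k A l0 dk kw wD A0 FD Fw Fk.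
  rewrite /nested_floor /= /A !subn0 in A0 *.
  by rewrite floor_ge_int; apply: card_family_bound FD Fw Fk => //; exact: ltnW.
rewrite nested_floorS floor_ge_int.
set B := nested_floor _ _ _ _.
have w0 : (0 < w)%N by apply: leq_ltn_trans kw.
have bound s : s \in D -> #|[set x in X | s \in F x]|%:Z <= B.
  move=> sD.
  have cD : #|D :\ s| = #|D|.-1 by rewrite (cardsD1 s D) sD.
  have := IH [set x in X | s \in F x] (fun x => F x :\ s) (D :\ s) w.-1 k.-1.
  (* Turning [(m - 1) - d] into [m - (d + 1)] makes the innermost bound of the induction hypothesis
     that of [B]. *)
  rewrite cD -!subn1 -!subnDA !add1n.
  rewrite /B -!subn1 => /(_ l0); apply => //.
  - by rewrite leq_subRL // (leq_trans _ dk).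
  - by rewrite ltn_sub2r // (leq_ltn_trans _ kw) // (leq_trans _ dk).
  - by rewrite leq_sub2r.
  - by move=> x; rewrite inE => /andP[xX _]; rewrite setSD // FD.
  - move=> x; rewrite inE => /andP[xX sx].
    by rewrite -(Fw x xX) (cardsD1 s (F x)) sx add1n subn1.
  - move=> x y; rewrite !inE => /andP[xX sx] /andP[yX sy] xy.
    (* Both members contain [s], so deleting it lowers their intersection by exactly one. *)
    have := Fk x y xX yX xy; rewrite (cardsD1 s) inE sx sy /=.
    by rewrite -setDIl; lia.
have count : (\sum_(s in D) #|[set x in X | s \in F x]| = #|X| * w)%N.
  transitivity (\sum_(s in D) \sum_(x in X) (s \in F x))%N.
    apply: eq_bigr => s _; rewrite -sum1dep_card big_mkcondr /=.
    by apply: eq_bigr => x _; case: (_ \in _).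
  rewrite exchange_big /= -sum_nat_const; apply: eq_bigr => x xX.
  rewrite -(Fw x xX) -sum1_card -big_mkcondr /=.
  apply: eq_bigl => s; rewrite andbC.
  by apply: andb_idr; exact: (subsetP (FD x xX)).
rewrite mulrAC ler_pdivlMr ?ltr0n //.
have : (#|X| * w)%N%:Z <= B *+ #|D|.
  rewrite -count -sumr_const (big_morph Posz PoszD (erefl 0%:Z)).
  exact: ler_sum.
by rewrite -(ler_int rat) PoszM intrM rmorphMn -[leRHS]mulr_natl.
Qed.

End SetFamilies.

Theorem theorem3 (S W K l d' : nat)
    (hK : (1 <= K)%N) (hKW : (K < W)%N) (hWS : (W <= S)%N)
    (hl : (1 <= l)%N) (hd1 : (1 <= d')%N) (hdK : (d' <= K)%N) :
  let S' := (S - d')%N in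
  let W' := (W - d')%N in
  let K' := (K - d')%N in
  let A := A_coef l S' W' in
  A - K'%:R ^+ l > 0 ->
  forall (N : nat) (X : {set word S}), is_cwc N W K X ->
  N%:Z <= nested_floor S W d'
            (Num.floor ((W'%:R ^+ l - K'%:R ^+ l) / (A - K'%:R ^+ l))).
Proof.
move=> S' W' K' A A0 N X [<- Xw Xk].
(* Passing to supports turns weights into cardinalities and overlaps into intersection sizes. *)
pose F (x : word S) := [set s | x s].
have FE x s : (s \in F x) = x s by rewrite inE.
have := @card_family_nested_floor _ _ X F [set: 'I_S] W K l d'.
rewrite cardsT card_ord; apply => // [x xX|x y xX yX xy].
- rewrite -(Xw x xX) /weight -sum1_card big_mkcond /=.
  by apply: eq_bigr => s _; rewrite FE; case: (x s).
- apply: leq_trans (Xk x y xX yX xy).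
  rewrite /overlap -sum1_card big_mkcond /=.
  by apply: leq_sum => s _; rewrite inE !FE; case: (x s); case: (y s).
Qed.
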